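(* Let $G$ be a graph with $\operatorname{nl}(G)=1$ and $\operatorname{Supp}(G)=[s]$, for some $s\in\mathbb{N}$. Then: (1) $G-v$ is singular if and only if $\operatorname{adj}(G)_{vv}=0$. (2) $\operatorname{adj}(G)_{uv}\ne 0$ if and only if $u,v\in\operatorname{Supp}(G)$. (3) $v\in\operatorname{Supp}(G)$ if and only if $G-v$ is nonsingular. (4) If $(x,0)^t\in\mathcal{N}(G)$, with $x\in\mathbb{R}^s\setminus\{0\}$, then \[x_v^2=\det(G-v)\det(G-u),\] for each $v\in\operatorname{Supp}(G)$ and some fixed $u\in\operatorname{Supp}(G)$.
   Context: Graphs are finite and simple, and $[s]=\{1,\dots,s\}$. $A(G)$ is the adjacency matrix of $G$ (over $\mathbb{R}$); $\mathcal{N}(G)$ is its nullspace, $\operatorname{nl}(G)=\dim\mathcal{N}(G)$, $\operatorname{adj}(G)=\operatorname{adj}(A(G))$ is the adjugate of $A(G)$ and $\det(G)=\det(A(G))$. A graph is singular if its adjacency matrix is singular, and nonsingular otherwise. $G-v$ is the graph obtained from $G$ by deleting the vertex $v$. $\operatorname{Supp}(G)$ is the set of vertices $v$ of $G$ such that $x_v\ne 0$ for some $x\in\mathcal{N}(G)$. The vertices are labeled so that those of $\operatorname{Supp}(G)=[s]$ come first, and vectors indexed by the vertices of $G$ are written $(x,0)^t$ with $x$ the part indexed by $\operatorname{Supp}(G)$ and $0$ the part indexed by the remaining vertices.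
   Formalization: Item (4) as printed fails since x can be rescaled (one-vertex graph, x=5: 25≠1); it is proved as: for every such x there are u in Supp(G) and a nonzero real c with (c x_v)^2 = det(G-v)det(G-u) for all v in Supp(G). *)

(* Defs.v *)
From mathcomp Require Import all_boot all_order all_algebra.
From mathcomp Require Import boolp classical_sets reals.
Set Implicit Arguments.
Unset Strict Implicit.
Unset Printing Implicit Defensive.
Import GRing.Theory.
Local Open Scope ring_scope.
Local Open Scope classical_set_scope.

Record sgraph (n : nat) := SGraph {
  edge :> rel 'I_n;
  edge_sym : symmetric edge;
  edge_irr : irreflexive edge }.

Lemma del_sym n (G : sgraph n) (v : 'I_n) :
  symmetric (fun i j : 'I_n.-1 => G (lift v i) (lift v j)).
Proof. by move=> i j; exact: edge_sym. Qed.

Lemma del_irr n (G : sgraph n) (v : 'I_n) :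
  irreflexive (fun i j : 'I_n.-1 => G (lift v i) (lift v j)).
Proof. by move=> i; exact: edge_irr. Qed.

(* G - v; the remaining vertices are relabelled by 'I_n.-1, in the same order,
   through the increasing bijection lift v onto 'I_n minus v. *)
Definition del_vertex n (G : sgraph n) (v : 'I_n) : sgraph n.-1 :=
  SGraph (@del_sym n G v) (@del_irr n G v).

Section AdjacencyMatrix.
Variables (R : realType) (n : nat).
Implicit Type G : sgraph n.

Definition adjacency G : 'M[R]_n := \matrix_(i, j) (G i j)%:R.

(* The space of column vectors x with A(G) x = 0; kermx is not used because it
   is the row kernel. *)
Definition nullspace G : {vspace 'cV[R]_n} :=
  lker (linfun (mulmx (adjacency G))).

Definition nullity G : nat := \dim (nullspace G).

Definition supp G : set 'I_n :=
  [set v | exists2 x : 'cV[R]_n, x \in nullspace G & x v 0 != 0].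

Definition nonsingular G : bool := adjacency G \in unitmx.

Definition singular G : bool := ~~ nonsingular G.

End AdjacencyMatrix.

(* Main.v *)
(** If the null space of a symmetric matrix A is the line spanned by z, then
    adj A is a nonzero multiple k z z^T: since A is singular, A (adj A) = 0, so
    the columns of adj A are multiples of z, and symmetry makes it a multiple
    of z z^T. It is nonzero because the principal minor at v is nonzero
    whenever z_v <> 0. All four claims are read off the entries k z_u z_v,
    the diagonal ones being the determinants det (G - v). *)

Require Import Defs.
From mathcomp Require Import all_boot all_order all_algebra.
From mathcomp Require Import boolp classical_sets reals.
Set Implicit Arguments.
Unset Strict Implicit.
Unset Printing Implicit Defensive.
Import GRing.Theory.
Local Open Scope ring_scope.
Local Open Scope classical_set_scope.

Lemma adj_diag (F : comNzRingType) (n : nat) (A : 'M[F]_n) (v : 'I_n) :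
  (\adj A) v v = \det (row' v (col' v A)).
Proof. by rewrite mxE /cofactor -signr_odd addnn odd_double mul1r. Qed.

Section KernelLine.
Variables (F : fieldType) (n : nat) (A : 'M[F]_n) (z : 'cV[F]_n).
Hypotheses (symA : A^T = A) (Az0 : A *m z = 0).
Hypothesis kerA : forall y : 'cV[F]_n, A *m y = 0 -> exists t, y = t *: z.

(* A null vector of the minor, extended by 0 at v, is sent by A to a multiple
   of e_v; pairing with z shows that the multiple is 0. *)
Lemma minor_ker_line (v : 'I_n) :
  z v 0 != 0 -> \det (row' v (col' v A)) != 0.
Proof.
move=> zv; apply/negP=> /det0P[y yN0 yB0].
pose y' : 'cV[F]_n := \col_i oapp (y 0) 0 (unlift v i).
have y'v : y' v 0 = 0 by rewrite mxE unlift_none.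
have y'l k : y' (lift v k) 0 = y 0 k by rewrite mxE liftK.
have Asym i j : A i j = A j i by rewrite -[in LHS]symA mxE.
(* Since [y'] vanishes at [v], only the entries of the minor contribute to these rows; symmetry
   turns the row null vector [y] into a column one. *)
have Ay'l k : (A *m y') (lift v k) 0 = 0.
  rewrite mxE (bigD1_ord v) //= y'v mulr0 add0r.
  transitivity ((y *m row' v (col' v A)) 0 k); last by rewrite yB0 mxE.
  rewrite mxE; apply: eq_bigr => i _.
  by rewrite y'l !mxE mulrC Asym.
have Ay'v : (A *m y') v 0 = 0.
  have : (z^T *m (A *m y')) 0 0 = 0.
    by rewrite mulmxA -{1}symA -trmx_mul Az0 trmx0 mul0mx mxE.
  rewrite mxE (bigD1_ord v) //= big1 ?addr0; last first.
    by move=> i _; rewrite Ay'l mulr0.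
  by move/eqP; rewrite mxE mulf_eq0 (negPf zv) => /eqP.
(* So [y'] lies on the line of [z]; as it vanishes at [v] while [z] does not, it is zero,
   contradicting [y != 0]. *)
have /kerA[t y'E] : A *m y' = 0.
  apply/colP=> i; rewrite [RHS]mxE.
  by case: (unliftP v i) => [k|] ->.
have t0 : t = 0.
  by move/eqP: y'v; rewrite y'E mxE mulf_eq0 (negPf zv) orbF => /eqP.
case/eqP: yN0; apply/rowP=> k.
by rewrite -y'l y'E t0 scale0r !mxE.
Qed.

Lemma adj_ker_line :
  z != 0 -> exists2 k, k != 0 & forall u v, (\adj A) u v = k * (z u 0 * z v 0).
Proof.
move=> zN0.
have [p zp] : exists p, z p 0 != 0.
  by have [i [j]] := matrix0Pn _ zN0; rewrite ord1; exists i.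
have detA0 : \det A = 0.
  apply/eqP/det0P; exists z^T; first by rewrite trmx_eq0.
  by rewrite -symA -trmx_mul Az0 trmx0.
have adjsym u v : (\adj A) u v = (\adj A) v u.
  by rewrite -[in LHS]symA -trmx_adj mxE.
have adjcol v : exists t, forall u, (\adj A) u v = t * z u 0.
  have /kerA[t colAE] : A *m col v (\adj A) = 0.
    by rewrite colE mulmxA mul_mx_adj detA0 raddf0 mul0mx.
  by exists t => u; have /colP/(_ u) := colAE; rewrite !mxE.
have [t tE] := adjcol p.
(* Column [v] is [w *: z] and column [p] is [t *: z]; equating the entries at [(p, v)] and [(v, p)]
   gives [w * z p 0 = t * z v 0]. *)
have adjE u v : (\adj A) u v = t / z p 0 * (z u 0 * z v 0).
  have [w wE] := adjcol v.
  have wp : w = t * z v 0 / z p 0.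
    by rewrite -tE adjsym wE mulfK.
  by rewrite wE wp -!mulrA [z u 0 * _]mulrC [z v 0 * (_ * _)]mulrCA.
exists (t / z p 0); last exact: adjE.
(* A zero constant would make the diagonal entry at [p] vanish, but that entry is a principal minor
   with [z p 0 != 0]. *)
apply/eqP=> k0.
by have := minor_ker_line zp; rewrite -adj_diag adjE k0 mul0r eqxx.
Qed.

End KernelLine.

Section GraphNullspace.
Variables (R : realType) (n : nat) (G : sgraph n).

Lemma adjacency_sym : (adjacency R G)^T = adjacency R G.
Proof. by apply/matrixP=> i j; rewrite !mxE edge_sym. Qed.

Lemma adjacency_del_vertex (v : 'I_n) :
  adjacency R (del_vertex G v) = row' v (col' v (adjacency R G)).
Proof. by apply/matrixP=> i j; rewrite !mxE. Qed.

Lemma nullspaceP (x : 'cV[R]_n) :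
  reflect (adjacency R G *m x = 0) (x \in nullspace R G).
Proof. by rewrite memv_ker lfunE; exact: eqP. Qed.

Hypothesis nlG : nullity R G = 1%N.

Lemma nullspace_line (z : 'cV[R]_n) :
  z \in nullspace R G -> z != 0 -> nullspace R G = <[z]>%VS.
Proof.
move=> zN zN0; apply/eqP; rewrite eq_sym eqEdim -memvE zN /=.
by rewrite dim_vline zN0 -/(nullity R G) nlG.
Qed.

Lemma nullspace_neq0 : exists2 z, z \in nullspace R G & z != 0.
Proof.
exists (vpick (nullspace R G)); first exact: memv_pick.
by rewrite vpick0 -dimv_eq0 -/(nullity R G) nlG.
Qed.

(** All null vectors are multiples of [z], so one nonzero null vector already detects the whole
    support. *)
Lemma supp_line (z : 'cV[R]_n) :
  z \in nullspace R G -> z != 0 -> forall v, supp R G v <-> z v 0 != 0.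
Proof.
move=> zN zN0 v; split=> [[x xN]|zv]; last by exists z.
move: xN; rewrite (nullspace_line zN zN0) => /vlineP[t ->].
by rewrite mxE mulf_eq0 negb_or => /andP[].
Qed.

(** The vector [z] is left free: claims (1) to (3) use a picked null vector, claim (4) the given
    one. *)
Lemma adj_nullspace (z : 'cV[R]_n) :
  z \in nullspace R G -> z != 0 ->
  exists2 k, k != 0 &
    forall u v, (\adj (adjacency R G)) u v = k * (z u 0 * z v 0).
Proof.
move=> zN zN0; apply: adj_ker_line => //; first exact: adjacency_sym.
  exact/nullspaceP.
by move=> y /nullspaceP; rewrite (nullspace_line zN zN0) => /vlineP.
Qed.

End GraphNullspace.

Lemma det_del_vertex (R : realType) (n : nat) (G : sgraph n) (v : 'I_n) :
  \det (adjacency R (del_vertex G v)) = (\adj (adjacency R G)) v v.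
Proof. by rewrite adjacency_del_vertex adj_diag. Qed.

Lemma nonsingular_del_vertex (R : realType) (n : nat) (G : sgraph n)
    (v : 'I_n) :
  nonsingular R (del_vertex G v) = ((\adj (adjacency R G)) v v != 0).
Proof. by rewrite /nonsingular unitmxE unitfE det_del_vertex. Qed.

Theorem theorem6p3 (R : realType) (s r : nat) (G : sgraph (s + r))
    (nlG : nullity R G = 1%N) (suppG : supp R G = range (@lshift s r)) :
  [/\ forall v : 'I_(s + r),
        singular R (del_vertex G v) <-> (\adj (adjacency R G)) v v = 0,
      forall u v : 'I_(s + r),
        (\adj (adjacency R G)) u v <> 0 <-> supp R G u /\ supp R G v,
      forall v : 'I_(s + r),
        supp R G v <-> nonsingular R (del_vertex G v)
    & forall x : 'cV[R]_s, x <> 0 -> col_mx x 0 \in nullspace R G ->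
        exists2 u : 'I_(s + r), supp R G u &
        exists2 c : R, c <> 0 &
        forall i : 'I_s,
          (c * x i 0) ^+ 2 =
            \det (adjacency R (del_vertex G (lshift r i))) *
            \det (adjacency R (del_vertex G u))].
Proof.
have [z zN zN0] := nullspace_neq0 nlG.
have suppE := supp_line nlG zN zN0.
have [k kN0 adjE] := adj_nullspace nlG zN zN0.
split=> [v|u v|v|x xN0 xN].
- by rewrite /singular nonsingular_del_vertex negbK; split=> /eqP.
- rewrite !suppE adjE; split=> [/eqP|[zu zv]].
    by rewrite !mulf_eq0 !negb_or => /and3P[].
  by apply/eqP; rewrite !mulf_neq0.
- by rewrite suppE nonsingular_del_vertex adjE !mulf_eq0 orbb negb_or kN0.
- have [i [j]] := matrix0Pn _ (introN eqP xN0); rewrite ord1 => xi.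
  have yN0 : col_mx x (0 : 'cV[R]_r) != 0.
    by rewrite col_mx_eq0 (introF eqP xN0).
  have [c cN0 adjEx] := adj_nullspace nlG xN yN0.
  exists (lshift r i); first by rewrite (supp_line nlG xN yN0) col_mxEu.
  (* With [u] the vertex of a nonzero entry [x i 0], the two determinants are [c * x a 0 ^+ 2] and
     [c * x i 0 ^+ 2], whose product is the square of [c * x i 0 * x a 0]. *)
  exists (c * x i 0); first by apply/eqP; rewrite mulf_neq0.
  move=> a; rewrite !det_del_vertex !adjEx !col_mxEu -!expr2 !exprMn.
  by rewrite [RHS]mulrACA -expr2 [x a 0 ^+ 2 * _]mulrC [RHS]mulrA.
Qed.
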